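(* For $k^2<\delta n$ we have $R_\delta(\mathrm{Ham}^n_k)=\Omega(k\log(k/\delta))$. The bound applies even to protocols that are only required to be correct (with probability at least $1-\delta$) on input pairs $(x,y)$ with $\|x-y\|_1\in\{k-2,k,k+2\}$ and may output an arbitrary answer on other inputs.
   Context: In the $k$-Hamming distance problem $\mathrm{Ham}^n_k$, Alice receives $x\in\{0,1\}^n$, Bob receives $y\in\{0,1\}^n$, and they must output 1 if $\|x-y\|_1\le k$ and 0 otherwise. A randomized two-party protocol lets the players exchange messages (bit strings), basing their actions on their own input, previous messages and a shared public random source; its error probability is the maximum over inputs of the probability that its output differs from the correct value; its communication cost is the maximum over inputs and random strings of the total number of bits exchanged. $R_\delta(f)$ is the minimum communication cost of a randomized protocol (with any number of rounds) computing $f$ with error probability at most $\delta$. Logarithms are base 2.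
   Formalization: The bound is proved for k ≥ 1 and 0 < δ ≤ 1/3, since it fails at δ ≥ 1/2 (random guessing costs nothing) and no absolute constant works as δ tends to 1/2; the public random source has finite support, which loses nothing for protocols of bounded cost. *)

(* Defs.v *)
From HB Require Import structures.
From mathcomp Require Import all_boot all_order all_algebra.
From mathcomp Require Import reals exp.
Set Implicit Arguments. Unset Strict Implicit. Unset Printing Implicit Defensive.
Import Order.TTheory GRing.Theory Num.Theory.
Local Open Scope ring_scope.

(** Deterministic two-party protocol trees.  At an Alice node, Alice sends
    one bit computed from her input (the history is encoded by the position
    in the tree); similarly for Bob.  A multi-bit message is a run of nodes
    owned by the same player.  Leaves carry the output. *)
Inductive proto (X Y : Type) : Type :=
| PLeaf of bool
| PAlice of (X -> bool) & proto X Y & proto X Y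
| PBob of (Y -> bool) & proto X Y & proto X Y.
Arguments PLeaf {X Y}.

Fixpoint run (X Y : Type) (P : proto X Y) (x : X) (y : Y) : bool :=
  match P with
  | PLeaf b => b
  | PAlice f l r => if f x then run r x y else run l x y
  | PBob g l r => if g y then run r x y else run l x y
  end.

Fixpoint bits (X Y : Type) (P : proto X Y) (x : X) (y : Y) : nat :=
  match P with
  | PLeaf _ => 0%N
  | PAlice f l r => (if f x then bits r x y else bits l x y).+1
  | PBob g l r => (if g y then bits r x y else bits l x y).+1
  end.

Definition bvec (n : nat) := {ffun 'I_n -> bool}.
Definition hamming (n : nat) (x y : bvec n) : nat := #|[set i | x i != y i]|.

Definition log2 (R : realType) (x : R) : R := ln x / ln 2.

(** A public-coin randomized protocol is a probability distribution
    [w] (finite support indexed by [I]) over deterministic protocols [P].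
    Its cost is the maximum over random strings and inputs of bits exchanged. *)
Definition rcost (n : nat) (I : finType) (P : I -> proto (bvec n) (bvec n)) : nat :=
  \max_(i : I) \max_(x : bvec n) \max_(y : bvec n) bits (P i) x y.

Definition err_prob (R : realType) (n : nat) (I : finType) (w : I -> R)
  (P : I -> proto (bvec n) (bvec n)) (x y : bvec n) (b : bool) : R :=
  \sum_(i : I | run (P i) x y != b) w i.

Definition ham_promise (n k : nat) (x y : bvec n) : Prop :=
  (hamming x y + 2 = k)%N \/ hamming x y = k \/ hamming x y = (k + 2)%N.

(* Main.v *)
Require Import Defs.
From HB Require Import structures.
From mathcomp Require Import all_boot all_order all_algebra.
From mathcomp Require Import reals exp.
From mathcomp Require Import sequences ring lra zify.
Set Implicit Arguments. Unset Strict Implicit. Unset Printing Implicit Defensive.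
Import Order.TTheory GRing.Theory Num.Theory.
Local Open Scope ring_scope.

(** For a symmetric nonnegative matrix [S] let [m_t = <v, S^t u>]. Condition the
    [t]-step [S]-walk on its endpoints ([v] at the start, [u] at the end) and let
    [p_s] be the law of its position at time [s]. Going back and forth once along
    the [i]-th edge, with the reversed and the forward conditional transition,
    yields a law [pi_i] on [(t+2)]-step walks; the relative entropies of the
    [pi_i] with respect to the walk measure telescope in [i], whence
    [m_(t+2) >= m_t^(1+2/t)] for unit vectors.

    By the arithmetic-geometric mean inequality, either
    [m_t <= m_(t-2)/4 + 16 m_(t+2)] or [p_(s-2)] and [p_s] are nearly singular for
    every [s]. In the second case test at every time [s] whether the position is
    more likely under [p_s] than under [p_(s-2)]: along a walk drawn from [pi_i]
    the answers look like [1..10..0] with the drop at [i], and by the maximal inequality [i] can be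
    decoded from the walk with probability [1/2]. The [t] laws [pi_i] thus occupy
    essentially disjoint parts of the walk space, which gains a factor
    [sqrt t / e].

    Apply this to the walk on the hypercube and to the at most [2^C] rectangles on
    which a protocol of cost [C] accepts: the accepted mass is nearly [1] after
    [k] steps and [O(delta)] after [k+2] steps, so the rectangles must be small.
    Since [k^2 < delta n], a [k]-step walk reaches distance exactly [k] except
    with probability [delta]. Constant errors are first decreased by majority
    votes, and [k] by padding the inputs. *)

(** * Sums over walks *)

Section Paths.
Context {R : realType} {T : finType} (S : T -> T -> R).
Hypothesis S_ge0 : forall x y, 0 <= S x y.
Hypothesis S_sym : forall x y, S x y = S y x.

Definition heat (f : T -> R) (x : T) : R := \sum_y S x y * f y.

Fixpoint wt (f : T -> R) (x : T) (s : seq T) : R :=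
  if s is y :: s' then S x y * wt f y s' else f x.

(* Walks with [l + r] steps, cut at time [l] in position [y]; the part [s] before
   the cut is listed backwards, so the walk itself is [catrev s (y :: q)]. *)
Definition psum (f g : T -> R) (l r : nat) (F : seq T -> T -> seq T -> R) : R :=
  \sum_y \sum_(s : l.-tuple T) \sum_(q : r.-tuple T)
     wt f y s * wt g y q * F s y q.

Lemma tuple_sum0 (F : seq T -> R) : \sum_(s : 0.-tuple T) F s = F [::].
Proof.
rewrite (eq_bigr (fun=> F [::])); last by move=> s _; rewrite (tuple0 s).
by rewrite sumr_const card_tuple expn0.
Qed.

Lemma tuple_sumS n (F : seq T -> R) :
  \sum_(s : n.+1.-tuple T) F s = \sum_x \sum_(s : n.-tuple T) F (x :: s).
Proof.
rewrite pair_big /=.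
rewrite (reindex (fun p : T * n.-tuple T => [tuple of p.1 :: p.2])) //=.
exists (fun s : n.+1.-tuple T => (thead s, [tuple of behead s])) => [[x s]|s] _ /=.
  by congr pair; apply: val_inj.
by rewrite -tuple_eta.
Qed.

Lemma heat_ge0 f : (forall x, 0 <= f x) -> forall x, 0 <= heat f x.
Proof. by move=> f0 x; apply: sumr_ge0 => y _; rewrite mulr_ge0. Qed.

Lemma iter_heat_ge0 n f : (forall x, 0 <= f x) -> forall x, 0 <= iter n heat f x.
Proof. by move=> f0; elim: n => [|n IH] //=; apply: heat_ge0. Qed.

Lemma heat_eq0 f x y : (forall x, 0 <= f x) -> heat f x = 0 -> S x y * f y = 0.
Proof.
move=> f0 /eqP; rewrite psumr_eq0 => [/allP/(_ y)|z _]; last by rewrite mulr_ge0.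
by rewrite mem_index_enum => /(_ isT) /eqP.
Qed.

Lemma heat_adj f g : \sum_x heat f x * g x = \sum_x f x * heat g x.
Proof.
rewrite (eq_bigr (fun x => \sum_y S x y * f y * g x)); last first.
  by move=> x _; rewrite mulr_suml.
rewrite exchange_big; apply: eq_bigr => y _ /=.
by rewrite mulr_sumr; apply: eq_bigr => x _; rewrite (S_sym x y); ring.
Qed.

Lemma iter_heat_adj n f g :
  \sum_x iter n heat f x * g x = \sum_x f x * iter n heat g x.
Proof.
elim: n f => [//|n IH] f.
rewrite iterSr IH heat_adj; apply: eq_bigr => x _.
by rewrite -iterS.
Qed.

Lemma wt_ge0 f : (forall x, 0 <= f x) -> forall x s, 0 <= wt f x s.
Proof. by move=> f0 x s; elim: s x => [|y s IH] x //=; rewrite mulr_ge0. Qed.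

Lemma wt_sum n f x : \sum_(s : n.-tuple T) wt f x s = iter n heat f x.
Proof.
elim: n x => [|n IH] x; first by rewrite (tuple_sum0 (wt f x)).
rewrite (tuple_sumS _ (wt f x)) /= /heat; apply: eq_bigr => y _.
by rewrite -IH mulr_sumr.
Qed.

Lemma wt_heat_eq0 n f x (s : n.-tuple T) : (forall x, 0 <= f x) ->
  iter n heat f x = 0 -> wt f x s = 0.
Proof.
move=> f0 /eqP; rewrite -wt_sum psumr_eq0 => [/allP/(_ s)|z _]; last exact: wt_ge0.
by rewrite mem_index_enum => /(_ isT) /eqP.
Qed.

Lemma psum_left f g l r (F : seq T -> T -> R) :
  psum f g l r (fun s y _ => F s y) =
  \sum_y \sum_(s : l.-tuple T) wt f y s * iter r heat g y * F s y.
Proof.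
apply: eq_bigr => y _; apply: eq_bigr => s _.
rewrite -wt_sum mulr_sumr mulr_suml; exact: eq_bigr.
Qed.

Lemma psum_right f g l r (F : T -> seq T -> R) :
  psum f g l r (fun _ y q => F y q) =
  \sum_y \sum_(q : r.-tuple T) iter l heat f y * wt g y q * F y q.
Proof.
apply: eq_bigr => y _; rewrite exchange_big; apply: eq_bigr => q _ /=.
rewrite -wt_sum mulr_suml mulr_suml; exact: eq_bigr.
Qed.

Lemma psum_mid f g l r (F : T -> R) :
  psum f g l r (fun _ y _ => F y) =
  \sum_y iter l heat f y * iter r heat g y * F y.
Proof.
rewrite psum_left; apply: eq_bigr => y _.
by rewrite -!wt_sum -2!mulr_suml.
Qed.

(** The edge next to the cut passes from the reversed left part to the right part; by symmetry of
    [S] its weight is the same in both directions. *)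
Lemma psum_shift f g l r (F : seq T -> R) :
  psum f g l.+1 r (fun s y q => F (catrev s (y :: q))) =
  psum f g l r.+1 (fun s y q => F (catrev s (y :: q))).
Proof.
rewrite /psum.
transitivity (\sum_x \sum_y \sum_(s : l.-tuple T) \sum_(q : r.-tuple T)
   S x y * wt f x s * wt g y q * F (catrev s (x :: y :: q))).
  rewrite [RHS]exchange_big; apply: eq_bigr => y _ /=.
  rewrite (tuple_sumS _ (fun s => \sum_(q : r.-tuple T)
    wt f y s * wt g y q * F (catrev s (y :: q)))).
  by apply: eq_bigr => x _ /=; rewrite S_sym.
apply: eq_bigr => x _; rewrite exchange_big /=; apply: eq_bigr => s _.
rewrite (tuple_sumS _ (fun q => wt f x s * wt g x q * F (catrev s (x :: q)))) /=.
by apply: eq_bigr => y _; apply: eq_bigr => q _; ring.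
Qed.

Lemma psum_split f g l r l' r' (F : seq T -> R) : (l + r = l' + r')%N ->
  psum f g l r (fun s y q => F (catrev s (y :: q))) =
  psum f g l' r' (fun s y q => F (catrev s (y :: q))).
Proof.
have H n m : psum f g n m (fun s y q => F (catrev s (y :: q))) =
   psum f g 0 (n + m) (fun s y q => F (catrev s (y :: q))).
  elim: n m => [//|n IH] m; by rewrite psum_shift IH addnS.
by move=> e; rewrite H e -H.
Qed.

Lemma eq_psum f g l r (F G : seq T -> T -> seq T -> R) :
  (forall (s : l.-tuple T) y (q : r.-tuple T),
      wt f y s * wt g y q * F s y q = wt f y s * wt g y q * G s y q) ->
  psum f g l r F = psum f g l r G.
Proof. by move=> H; do 3![apply: eq_bigr => ? _]. Qed.

Lemma le_psum f g l r (F G : seq T -> T -> seq T -> R) :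
  (forall x, 0 <= f x) -> (forall x, 0 <= g x) ->
  (forall (s : l.-tuple T) y (q : r.-tuple T), F s y q <= G s y q) ->
  psum f g l r F <= psum f g l r G.
Proof.
move=> f0 g0 H; do 3![apply: ler_sum => ? _].
by rewrite ler_wpM2l ?mulr_ge0 ?wt_ge0.
Qed.

Lemma psumD f g l r (F G : seq T -> T -> seq T -> R) :
  psum f g l r (fun s y q => F s y q + G s y q) =
  psum f g l r F + psum f g l r G.
Proof.
rewrite /psum -big_split; apply: eq_bigr => y _ /=.
rewrite -big_split; apply: eq_bigr => s _ /=.
by rewrite -big_split; apply: eq_bigr => q _ /=; rewrite mulrDr.
Qed.

Lemma psumZ f g l r c (F : seq T -> T -> seq T -> R) :
  psum f g l r (fun s y q => c * F s y q) = c * psum f g l r F.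
Proof.
rewrite /psum mulr_sumr; apply: eq_bigr => y _ /=.
rewrite mulr_sumr; apply: eq_bigr => s _ /=.
by rewrite mulr_sumr; apply: eq_bigr => q _ /=; rewrite mulrCA.
Qed.

Lemma psum_sum f g l r (I : Type) (e : seq I) (P : pred I)
    (F : I -> seq T -> T -> seq T -> R) :
  psum f g l r (fun s y q => \sum_(i <- e | P i) F i s y q) =
  \sum_(i <- e | P i) psum f g l r (F i).
Proof.
rewrite /psum [RHS]exchange_big; apply: eq_bigr => y _ /=.
rewrite [RHS]exchange_big; apply: eq_bigr => s _ /=.
rewrite [RHS]exchange_big; apply: eq_bigr => q _ /=.
by rewrite mulr_sumr.
Qed.

(* Reversibility: leaving [y] backwards along the conditioned walk and coming
   back is a probability kernel. The quotients are [0] off their supports. *)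
Lemma heat_bridge f g y : (forall x, 0 <= f x) -> (forall x, 0 <= g x) ->
  heat f y != 0 ->
  g y / heat f y * (\sum_z S y z * (f z / heat g z * heat g z)) = g y.
Proof.
move=> f0 g0 Fy; have [->|gy] := eqVneq (g y) 0; first by rewrite !mul0r.
rewrite (eq_bigr (fun z => S y z * f z)); first by rewrite -mulrA mulVf ?mulr1.
move=> z _; have [Gz|Gz] := eqVneq (heat g z) 0; last by rewrite divfK.
have /eqP := heat_eq0 y g0 Gz.
by rewrite mulf_eq0 (negPf gy) orbF S_sym => /eqP ->; rewrite !mul0r.
Qed.

(* Up to normalization, the density of [pi_i] with respect to the walk measure:
   it only depends on the positions [y], [z] at times [i + 1] and [i + 2]. *)
Definition backratio (f g : T -> R) (i j : nat) (y z : T) : R :=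
  iter j heat g y / iter i.+1 heat f y * (iter i heat f z / iter j.+1 heat g z).

(** Up to the turning point at time [i + 1], [pi_i] is the conditioned walk of [i + 1 + j] steps:
    the backward kernel sums to [1]. *)
Lemma psum_back_left f g i j (F : seq T -> T -> R) :
  (forall x, 0 <= f x) -> (forall x, 0 <= g x) ->
  psum f g i.+1 j.+2 (fun s y q => backratio f g i j y (head y q) * F s y) =
  psum f g i.+1 j (fun s y _ => F s y).
Proof.
move=> f0 g0; rewrite psum_left /psum.
apply: eq_bigr => y _; apply: eq_bigr => s _.
rewrite (tuple_sumS _ (fun q => wt f y s * wt g y q *
  (backratio f g i j y (head y q) * F s y))) /=.
have [/wt_heat_eq0 ->//|H] := eqVneq (iter i.+1 heat f y) 0.
  by rewrite !mul0r; do 2!(apply: big1 => ? _); rewrite !mul0r.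
rewrite -[in RHS](heat_bridge (iter_heat_ge0 i f0) (iter_heat_ge0 j g0) H).
rewrite mulrA mulr_sumr mulr_suml; apply: eq_bigr => z _.
rewrite -[X in _ * (_ * (_ * X))](wt_sum j.+1 g z).
rewrite !mulr_sumr mulr_suml; apply: eq_bigr => q _.
by rewrite /backratio /=; ring.
Qed.

(** From time [i + 2] on, [pi_i] is the conditioned walk from time [i] on: here the forward kernel
    from [z] to [y] sums to [1]. *)
Lemma psum_back_right f g i j (F : seq T -> R) :
  (forall x, 0 <= f x) -> (forall x, 0 <= g x) ->
  psum f g i.+1 j.+2 (fun s y q => backratio f g i j y (head y q) * F q) =
  psum f g i j.+1 (fun _ y q => F (y :: q)).
Proof.
move=> f0 g0; rewrite (psum_right f g i.+1 j.+2 (fun y q =>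
  backratio f g i j y (head y q) * F q)).
rewrite (psum_right f g i j.+1 (fun y q => F (y :: q))).
under eq_bigr => y _ do rewrite (tuple_sumS _ (fun q => iter i.+1 heat f y *
  wt g y q * (backratio f g i j y (head y q) * F q))).
rewrite exchange_big; apply: eq_bigr => z _ /=.
rewrite exchange_big; apply: eq_bigr => q _ /=.
have [/wt_heat_eq0 ->//|H] := eqVneq (iter j.+1 heat g z) 0.
  by rewrite !mulr0 mul0r; apply: big1 => ? _; rewrite !(mulr0, mul0r).
rewrite -[in RHS](heat_bridge (iter_heat_ge0 j g0) (iter_heat_ge0 i f0) H).
rewrite mulr_sumr !mulr_suml; apply: eq_bigr => y _.
by rewrite /backratio /= (S_sym y z); ring.
Qed.

End Paths.

(** * A maximal inequality *)

Section Maximal.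
Local Open Scope nat_scope.

Definition sparse (l : seq bool) : bool :=
  all (fun j => (count id (take j l)).*2 < j) (iota 1 (size l)).

(* The length of a queue fed two items per [true] and serving one per step,
   read from the right end: [l] is sparse as soon as it never waits. *)
Fixpoint load (l : seq bool) : nat :=
  if l is b :: l' then (load l' + b.*2).-1 else 0.

Lemma take_load j l : (count id (take j l)).*2 <= j + load l.
Proof.
elim: l j => [|b l IH] [|j] //=.
have := IH j; case: b => /=; lia.
Qed.

Lemma sparse_load (b : bool) l : load l + b.*2 = 0 -> sparse (b :: l).
Proof.
case: b => [|h]; first by rewrite addnC.
apply/allP => -[|j]; rewrite mem_iota //= => _.
have := take_load j l; lia.
Qed.

(** A suffix that is not sparse marks a step at which the queue serves an item. Each [true] brings
    two items, of which [load l] in all are still waiting. *)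
Lemma load_sparse l :
  load l + \sum_(0 <= i < size l) ~~ sparse (drop i l) <= (count id l).*2.
Proof.
elim: l => [|b l IH]; first by rewrite big_nil.
rewrite big_nat_recl // [drop 0 _]/= /=.
set X := \sum_(0 <= i < _) _ in IH *.
have := @sparse_load b l; case: (sparse _) => [_|H].
  by move: IH; case: b => /=; lia.
have : load l + b.*2 != 0 by apply/eqP => /H.
by move: IH; case: b {H} => /=; lia.
Qed.

(** Decoding a drop after time [i]: zeros are a strict minority in each window ending at [i], and
    for [rightok] ones are in each window starting at [i + 1]. *)
Definition leftok (f : nat -> bool) i :=
  sparse [seq ~~ f s | s <- rev (iota 0 i.+1)].
Definition rightok (f : nat -> bool) t i :=
  sparse [seq f s | s <- iota i.+1 (t - i)].

Lemma sum_leftok f t :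
  \sum_(i < t) ~~ leftok f i.+1 <= (\sum_(0 <= s < t.+1) ~~ f s).*2.
Proof.
have := load_sparse [seq ~~ f s | s <- rev (iota 0 t.+1)].
rewrite count_map count_rev size_map size_rev size_iota big_nat_recr // => H.
have -> : \sum_(0 <= s < t.+1) ~~ f s = count (preim (fun s => ~~ f s) id) (iota 0 t.+1).
  by rewrite -sum1_count /index_iota subn0 [RHS]big_mkcond /=; apply: eq_bigr => s _; case: (f s).
apply: leq_trans H; rewrite addnA; apply: leq_trans (leq_addr _ _).
apply: leq_trans (leq_addl _ _).
rewrite big_mkord (reindex_inj rev_ord_inj).
apply: leq_sum => i _.
rewrite /leftok -map_drop drop_rev size_iota -[X in iota 0 X.+2]/(t - i.+1)%N.
rewrite (_ : take _ (iota 0 t.+1) = iota 0 (t.+1 - i)); last first.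
  by rewrite take_iota; congr iota; lia.
by rewrite (_ : (t - i.+1).+2 = t.+1 - i) // ; have := ltn_ord i; lia.
Qed.

Lemma sum_rightok f t :
  \sum_(i < t) ~~ rightok f t i.+1 <= (\sum_(2 <= s < t.+1) f s).*2.
Proof.
case: t => [|t]; first by rewrite big_ord0.
have := load_sparse [seq f s | s <- iota 2 t].
rewrite count_map size_map size_iota => H.
have -> : \sum_(2 <= s < t.+2) f s = count (preim f id) (iota 2 t).
  by rewrite -sum1_count /index_iota !subSS subn0 [RHS]big_mkcond /=; apply: eq_bigr => s _; case: (f s).
apply: leq_trans H; apply: leq_trans (leq_addl _ _).
rewrite big_ord_recr /= {2}/rightok subnn /= addn0 big_mkord.
apply: leq_sum => i _.
rewrite /rightok -map_drop drop_iota addnC subSS.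
by rewrite addn2.
Qed.

(** In the window from [i + 1] to [j] zeros and ones would both be strict minorities. *)
Lemma ok_unique f t i j : i < j -> j <= t -> leftok f j -> rightok f t i -> False.
Proof.
move=> ij jt /allP /(_ (j - i)) L /allP /(_ (j - i)) Rt.
move: L; rewrite mem_iota size_map size_rev size_iota -map_take take_rev size_iota.
rewrite drop_iota count_map count_rev => L.
move: Rt; rewrite mem_iota size_map size_iota -map_take take_iota count_map => Rt.
have {}L : (count (predC f) (iota i.+1 (j - i))).*2 < j - i.
  have := L; rewrite (_ : 0 + (j.+1 - (j - i)) = i.+1); last lia.
  rewrite (_ : j.+1 - (j.+1 - (j - i)) = j - i); last lia.
  by apply; lia.
have {}Rt : (count f (iota i.+1 (j - i))).*2 < j - i.
  have := Rt; rewrite (_ : minn _ _ = j - i); last lia.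
  by apply; lia.
have := count_predC f (iota i.+1 (j - i)); rewrite size_iota; lia.
Qed.

End Maximal.

(** * Near log-convexity *)

Section Entropy.
Context {R : realType}.
Implicit Types c m U : R.

Lemma ln_le_sub1 (x : R) : 0 < x -> ln x <= x - 1.
Proof. by move=> x0; have := @le_ln1Dx R (x - 1); rewrite addrCA subrr addr0; apply; lra. Qed.

(** Tangent line of the concave function [- z ln (z / m)] at [z = m / c]. *)
Lemma xlnx_le (z : R) m c : 0 <= z -> 0 < m -> 0 < c ->
  z * - ln (z / m) <= z * (ln c - 1) + m / c.
Proof.
rewrite le_eqVlt => /predU1P[<-|z0] m0 c0.
  by rewrite !mul0r add0r divr_ge0 ?ltW.
have H := @ln_le_sub1 (m / (z * c)) (divr_gt0 m0 (mulr_gt0 z0 c0)).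
rewrite ln_div ?posrE ?mulr_gt0 // lnM ?posrE // in H.
rewrite ln_div ?posrE //.
have -> : m / c = z * (m / (z * c)) by field; rewrite !gt_eqF.
by rewrite -mulrDr ler_pM2l //; lra.
Qed.

Lemma gibbs_le (x y : R) m U : 0 <= x -> 0 <= y -> 0 < m -> 0 < U ->
  x * y * (ln (m / U) + 1) - m * y ^+ 2 / U <= x * y * ln (x / y).
Proof.
move=> x0 y0 m0 U0.
have [->|yn0] := eqVneq y 0; first by rewrite !mulr0 !mul0r expr0n /= mulr0 mul0r subr0.
have {yn0}y0 : 0 < y by rewrite lt_def yn0.
move: x0; rewrite le_eqVlt => /predU1P[<-|x0].
  by rewrite !mul0r add0r oppr_le0 divr_ge0 ?mulr_ge0 ?sqr_ge0 ?ltW.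
have H := @ln_le_sub1 (m / U * (y / x)) (mulr_gt0 (divr_gt0 m0 U0) (divr_gt0 y0 x0)).
rewrite lnM ?posrE ?divr_gt0 // [ln (y / x)]ln_div ?posrE // in H.
rewrite [ln (x / y)]ln_div ?posrE //.
have -> : m * y ^+ 2 / U = x * y * (m / U * (y / x)) by field; rewrite !gt_eqF.
by rewrite -mulrBr ler_pM2l ?mulr_gt0 //; lra.
Qed.

(** The relative entropy of the law [f g / m], where [m] is the sum of [f g], with respect to the
    subprobability [g ^ 2 / U] is nonnegative. *)
Lemma gibbs_sum (T : finType) (f g : T -> R) U :
  (forall x, 0 <= f x) -> (forall x, 0 <= g x) -> 0 < U ->
  \sum_x g x ^+ 2 <= U -> 0 < \sum_x f x * g x ->
  (\sum_x f x * g x) * ln ((\sum_x f x * g x) / U) <=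
  \sum_x f x * g x * ln (f x / g x).
Proof.
move=> f0 g0 U0 gU m0; set m := \sum_x f x * g x in m0 *.
have H : \sum_x (f x * g x * (ln (m / U) + 1) - m * g x ^+ 2 / U) <=
    \sum_x f x * g x * ln (f x / g x).
  by apply: ler_sum => x _; apply: gibbs_le.
apply: le_trans H; rewrite sumrB -mulr_suml -/m mulrDr mulr1.
suff : \sum_i m * g i ^+ 2 / U <= m by lra.
by rewrite -!mulr_suml -mulr_sumr -mulrA ger_pMr // ler_pdivrMr ?mul1r.
Qed.

End Entropy.

(** * Walks that retrace one edge, and decoding of that edge *)

Section NearLogConvexity.
Context {R : realType} {T : finType} (S : T -> T -> R).
Hypothesis S_ge0 : forall x y, 0 <= S x y.
Hypothesis S_sym : forall x y, S x y = S y x.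
Variables (u v : T -> R) (x0 : T) (t : nat).
Hypothesis u_ge0 : forall x, 0 <= u x.
Hypothesis v_ge0 : forall x, 0 <= v x.

Local Notation pow i f := (iter i (heat S) f).
Local Notation ps := (psum S v u).

Definition measured n : R := \sum_x v x * pow n u x.

Lemma measured_split i j : \sum_x pow i v x * pow j u x = measured (i + j).
Proof.
by rewrite (iter_heat_adj S_sym); apply: eq_bigr => x _; rewrite -iterD.
Qed.

Lemma psum1 i j : ps i j (fun _ _ _ => 1) = measured (i + j).
Proof.
rewrite (psum_mid S v u i j (fun=> 1)) -measured_split.
by apply: eq_bigr => x _; rewrite mulr1.
Qed.

(* [m] times the expectation of [ln (a_i / b_i)] under [p_i = a_i b_i / m]. *)
Definition potential i : R :=
  \sum_y pow i v y * pow (t - i) u y * ln (pow i v y / pow (t - i) u y).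

Local Notation m := (measured t).
Local Notation B i := (backratio S v u i (t - i.+1)).
Local Notation pb i F := (ps i.+1 (t - i.+1).+2 F).

Lemma backratio_ge0 i y z : 0 <= B i y z.
Proof. by rewrite !mulr_ge0 ?invr_ge0 ?(iter_heat_ge0 S_ge0). Qed.

Lemma psum_back1 i : (i < t)%N ->
  pb i (fun s y q => B i y (head y q)) = m.
Proof.
move=> it; transitivity (pb i (fun s y q => B i y (head y q) * 1)).
  by apply: eq_psum => *; rewrite mulr1.
rewrite (psum_back_left S_ge0 S_sym _ _ (fun _ _ => 1)) // psum1.
by congr measured; lia.
Qed.

(** [backratio] is [a_i / b_i] at [z] divided by [a_(i+1) / b_(i+1)] at [y], and under [pi_i] the
    points [y], [z] have laws [p_(i+1)], [p_i]; so the logarithm splits into two potentials. *)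
Lemma psum_entropy i : 0 < m -> (i < t)%N ->
  pb i (fun s y q => B i y (head y q) * - ln (B i y (head y q) / m)) =
  m * ln m + potential i.+1 - potential i.
Proof.
move=> m0 it.
pose G j y := ln (pow j v y / pow (t - j) u y).
pose F q := if q is z :: _ then - G i z else 0.
transitivity (pb i (fun s y q => (ln m * B i y (head y q) +
    B i y (head y q) * G i.+1 y) + B i y (head y q) * F q)).
  apply: eq_psum => s y q; congr (_ * _).
  case/tupleP: q => z q /=; have := backratio_ge0 i y z.
  rewrite le_eqVlt => /predU1P[<-|b0]; first by rewrite !mul0r mulr0 !addr0.
  have e : B i y z = (pow i v z / pow (t - i) u z) / (pow i.+1 v y / pow (t - i.+1) u y).
    rewrite /backratio (_ : (t - i.+1).+1 = t - i)%N; last lia.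
    by rewrite invf_div mulrC.
  have ge j w : 0 <= pow j v w / pow (t - j) u w.
    by rewrite divr_ge0 ?(iter_heat_ge0 S_ge0).
  have p1 : 0 < pow i v z / pow (t - i) u z.
    by rewrite lt_def ge andbT; apply: contraTneq b0 => e0; rewrite e e0 mul0r ltxx.
  have p2 : 0 < pow i.+1 v y / pow (t - i.+1) u y.
    by rewrite lt_def ge andbT; apply: contraTneq b0 => e0; rewrite e e0 invr0 mulr0 ltxx.
  rewrite {2}e ln_div ?posrE ?(divr_gt0 p1 p2) // [ln (_ / _ / _)]ln_div ?posrE //.
  by rewrite /G; ring.
rewrite !psumD psumZ psum_back1 // mulrC; congr (_ + _).
  congr (_ + _).
  rewrite (psum_back_left S_ge0 S_sym _ _ (fun _ y => G i.+1 y)) //.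
  by rewrite (psum_mid S v u _ _ (G i.+1)).
rewrite (psum_back_right S_ge0 S_sym _ _ F) //= (psum_mid S v u _ _ (fun y => - G i y)).
rewrite /potential -sumrN (_ : (t - i.+1).+1 = t - i)%N; last lia.
by apply: eq_bigr => y _; rewrite mulrN.
Qed.

(** [gibbs_sum] at both ends: [S^t v] against [u] bounds [potential t], and [S^t u] against [v]
    bounds [- potential 0]. *)
Lemma potential_ends U : 0 < m -> 0 < U ->
  \sum_x u x ^+ 2 <= U -> \sum_x v x ^+ 2 <= U ->
  2 * (m * ln (m / U)) <= potential t - potential 0.
Proof.
move=> m0 U0 uU vU.
have e1 : \sum_x pow t v x * u x = m by rewrite (iter_heat_adj S_sym).
have e2 : \sum_x pow t u x * v x = m by apply: eq_bigr => x _; rewrite mulrC.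
have := gibbs_sum (iter_heat_ge0 S_ge0 t v_ge0) u_ge0 U0 uU.
have := gibbs_sum (iter_heat_ge0 S_ge0 t u_ge0) v_ge0 U0 vU.
rewrite e1 e2 => /(_ m0) H1 /(_ m0) H2.
have -> : potential t = \sum_x pow t v x * u x * ln (pow t v x / u x).
  by rewrite /potential subnn.
have -> : potential 0 = - \sum_x pow t u x * v x * ln (pow t u x / v x).
  rewrite /potential subn0 -sumrN; apply: eq_bigr => x _ /=.
  have := iter_heat_ge0 S_ge0 t u_ge0 x; rewrite le_eqVlt => /predU1P[<-|p1].
    by rewrite mulr0 !mul0r oppr0.
  have := v_ge0 x; rewrite le_eqVlt => /predU1P[<-|p2].
    by rewrite !(mul0r, mulr0) oppr0.
  by rewrite !ln_div ?posrE //; ring.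
by rewrite opprK; lra.
Qed.

(* The unnormalized law [m p_k]. *)
Definition occ k x : R := pow k v x * pow (t - k) u x.
(** The likelihood test. At times 0 and 1 there is no [p_(k-2)], and the answer is 1 as expected
    before the drop. *)
Definition later k x : bool := (k < 2)%N || (occ k.-2 x <= occ k x).

Lemma nth_catrev_le s y q k : (k <= size s)%N ->
  nth x0 (catrev s (y :: q)) k = nth x0 (catrev s [:: y]) k.
Proof.
move=> ks; rewrite !catrevE !nth_cat size_rev; case: ltngtP ks => // -> _.
by rewrite subnn.
Qed.

Lemma nth_catrev_ge s q k :
  nth x0 (catrev s q) (size s + k) = nth x0 q k.
Proof. by rewrite catrevE nth_cat size_rev ltnNge leq_addr /= addKn. Qed.

Lemma eq_leftok f g i : (forall k, (k <= i)%N -> f k = g k) -> leftok f i = leftok g i.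
Proof.
move=> e; congr sparse; apply/eq_in_map => k.
by rewrite mem_rev mem_iota => ki; rewrite e.
Qed.

Lemma eq_rightok f g i : (forall k, (i < k <= t)%N -> f k = g k) ->
  rightok f t i = rightok g t i.
Proof.
by move=> e; congr sparse; apply/eq_in_map => k; rewrite mem_iota => ki; rewrite e //; lia.
Qed.

Definition marks (p : seq T) k := later k (nth x0 p k).

(* What [marks] becomes after the drop: there, a walk drawn from [pi_i] is two
   steps late. *)
Definition shifted (p : seq T) k := later k (nth x0 p k.-2).

Lemma psum_occ k (F : T -> R) : (k <= t)%N ->
  ps 0 t (fun s y q => F (nth x0 (catrev s (y :: q)) k)) = \sum_x occ k x * F x.
Proof.
move=> kt; rewrite (psum_split S_sym v u (l' := k) (r' := t - k)
  (fun p => F (nth x0 p k))); last lia.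
rewrite -(psum_mid S v u k (t - k)%N F); apply: eq_psum => s y q.
by rewrite -{5}[k](size_tuple s) -[size s]addn0 nth_catrev_ge.
Qed.

(** [leftok] at [i + 1] reads only positions up to the turning point, where [pi_i] agrees with the
    conditioned walk. *)
Lemma psum_not_left i : (i < t)%N ->
  pb i (fun s y q => B i y (head y q) * (~~ leftok (marks (catrev s (y :: q))) i.+1)%:R) =
  ps 0 t (fun s y q => (~~ leftok (marks (catrev s (y :: q))) i.+1)%:R).
Proof.
move=> it.
have H l r (s : l.-tuple T) y (q : r.-tuple T) : l = i.+1 ->
  leftok (marks (catrev s (y :: q))) i.+1 = leftok (marks (catrev s [:: y])) i.+1.
  move=> e; apply: eq_leftok => k ki; rewrite /marks nth_catrev_le //.
  by rewrite size_tuple e.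
pose F s y : R := (~~ leftok (marks (catrev s [:: y])) i.+1)%:R.
transitivity (pb i (fun s y q => B i y (head y q) * F s y)).
  by apply: eq_psum => s y q; rewrite H.
rewrite (psum_back_left S_ge0 S_sym _ _ F) //.
rewrite [RHS](psum_split S_sym v u (l' := i.+1) (r' := t - i.+1)
  (fun p => (~~ leftok (marks p) i.+1)%:R)); last lia.
by apply: eq_psum => s y q; rewrite H.
Qed.

(** [rightok] at [i + 1] reads only positions from time [i + 2] on, where [pi_i] is the conditioned
    walk two steps late. *)
Lemma psum_not_right i : (i < t)%N ->
  pb i (fun s y q => B i y (head y q) * (~~ rightok (marks (catrev s (y :: q))) t i.+1)%:R) =
  ps 0 t (fun s y q => (~~ rightok (shifted (catrev s (y :: q))) t i.+1)%:R).
Proof.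
move=> it.
pose F q : R := (~~ rightok (fun k => later k (nth x0 q (k - i.+2))) t i.+1)%:R.
transitivity (pb i (fun s y q => B i y (head y q) * F q)).
  apply: eq_psum => s y q; congr (_ * (_ * (~~ _)%:R)); apply: eq_rightok => k ki.
  rewrite /marks; congr later.
  rewrite -[RHS]/(nth x0 (y :: q) (k - i.+2).+1) -[RHS](nth_catrev_ge s).
  by congr nth; rewrite size_tuple; lia.
rewrite (psum_back_right S_ge0 S_sym _ _ F) //.
rewrite [RHS](psum_split S_sym v u (l' := i) (r' := (t - i.+1).+1)
  (fun p => (~~ rightok (shifted p) t i.+1)%:R)); last lia.
apply: eq_psum => s y q; congr (_ * (~~ _)%:R); apply: eq_rightok => k ki.
rewrite /shifted; congr later; rewrite -[LHS](nth_catrev_ge s).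
by congr nth; rewrite size_tuple; lia.
Qed.

(** By the maximal inequality the failures are at most twice the wrong answers. At each time the two
    error masses of the test add up to the sum of minima, at most [m / 4]; so at least half of the
    total mass [t m] is decoded. *)
Lemma sum_not_ok :
  (forall k, (2 <= k <= t)%N -> \sum_x Num.min (occ k.-2 x) (occ k x) <= m / 4) ->
  0 <= m ->
  \sum_(i < t) ps 0 t (fun s y q => (~~ leftok (marks (catrev s (y :: q))) i.+1)%:R) +
  \sum_(i < t) ps 0 t (fun s y q => (~~ rightok (shifted (catrev s (y :: q))) t i.+1)%:R)
  <= t%:R * m / 2.
Proof.
move=> Hmin m0; rewrite -!psum_sum.
have HL : ps 0 t (fun s y q => \sum_(i < t) (~~ leftok (marks (catrev s (y :: q))) i.+1)%:R)
  <= 2 * \sum_(2 <= k < t.+1) \sum_x occ k x * (~~ later k x)%:R.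
  apply: (@le_trans _ _ (ps 0 t (fun s y q => 2 * \sum_(2 <= k < t.+1)
      (~~ marks (catrev s (y :: q)) k)%:R))).
    apply: le_psum => // s y q; rewrite -!natr_sum -natrM ler_nat mul2n.
    apply: leq_trans (sum_leftok _ _) _; rewrite leq_double.
    (* Times 0 and 1 drop out, since [later] holds there. *)
    rewrite big_ltn //=; case: (posnP t) => [e|t0]; first by rewrite [X in (0 + X)%N]big_geq ?e.
    by rewrite big_ltn.
  rewrite psumZ psum_sum ler_pM2l // !big_nat ler_sum // => k kt.
  by rewrite (psum_occ (fun x => (~~ later k x)%:R)) //; lia.
have HR : ps 0 t (fun s y q => \sum_(i < t) (~~ rightok (shifted (catrev s (y :: q))) t i.+1)%:R)
  <= 2 * \sum_(2 <= k < t.+1) \sum_x occ k.-2 x * (later k x)%:R.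
  apply: (@le_trans _ _ (ps 0 t (fun s y q => 2 * \sum_(2 <= k < t.+1)
      (shifted (catrev s (y :: q)) k)%:R))).
    apply: le_psum => // s y q; rewrite -!natr_sum -natrM ler_nat mul2n.
    exact: sum_rightok.
  rewrite psumZ psum_sum ler_pM2l // !big_nat ler_sum // => k kt.
  by rewrite (psum_occ (fun x => (later k x)%:R)) //; lia.
apply: le_trans (lerD HL HR) _; rewrite -mulrDr -big_split /=.
apply: (@le_trans _ _ (2 * \sum_(2 <= k < t.+1) m / 4)).
  rewrite ler_pM2l // !big_nat ler_sum // => k kt.
  apply: le_trans (Hmin k _); last lia.
  rewrite -big_split ler_sum //= => x _.
  rewrite /later ltnNge (_ : (1 < k)%N) /=; last lia.
  by case: (leP (occ k.-2 x) (occ k x)) => _ /=; lra.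
rewrite -mulr_suml sumr_const_nat -mulr_natr.
have : ((t.+1 - 2)%:R : R) <= t%:R by rewrite ler_nat; lia.
move=> h; have := ler_wpM2l m0 h; lra.
Qed.

(** By [ok_unique] a walk decodes to at most one [i], so these events are disjoint. *)
Lemma sum_ok :
  \sum_(i < t) pb i (fun s y q => (leftok (marks (catrev s (y :: q))) i.+1 &&
       rightok (marks (catrev s (y :: q))) t i.+1)%:R) <= measured t.+2.
Proof.
rewrite (eq_bigr (fun i : 'I_t => ps 0 t.+2 (fun s y q =>
    (leftok (marks (catrev s (y :: q))) i.+1 &&
     rightok (marks (catrev s (y :: q))) t i.+1)%:R))); last first.
  move=> i _; apply: (psum_split S_sym v u (fun p => (leftok (marks p) i.+1 &&
     rightok (marks p) t i.+1)%:R)).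
  by have := ltn_ord i; lia.
rewrite -psum_sum -[t.+2]add0n -psum1; apply: le_psum => // s y q.
set f := marks _; rewrite -natr_sum (ler_nat _ _ 1).
have [/existsP[i Hi]|/existsPn H] := boolP [exists i : 'I_t, leftok f i.+1 && rightok f t i.+1].
  rewrite (bigD1 i) //= big1 ?addn0 ?leq_b1 // => j ji.
  apply/eqP; rewrite eqb0; apply/negP => Hj.
  move: Hi Hj => /andP[L1 R1] /andP[L2 R2].
  have : i != j :> nat by rewrite eq_sym.
  rewrite neq_ltn => /orP[] ij.
    by apply: (@ok_unique f t i.+1 j.+1).
  by apply: (@ok_unique f t j.+1 i.+1).
by rewrite big1 // => i _; rewrite (negPf (H i)).
Qed.

(** Exponentiated: [M >= m (m / U)^(2/t) sqrt t / e]. The entropies of the [pi_i] telescope; each is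
    bounded above by tangent lines, chosen according to whether the walk decodes to [i]. *)
Lemma near_log_convexity M U : (0 < t)%N -> 0 < m -> 0 < U ->
  \sum_x u x ^+ 2 <= U -> \sum_x v x ^+ 2 <= U ->
  (forall k, (2 <= k <= t)%N -> \sum_x Num.min (occ k.-2 x) (occ k x) <= m / 4) ->
  0 < M -> measured t.+2 <= M ->
  t%:R * ln m + 2 * ln (m / U) + t%:R / 2 * ln t%:R <= t%:R * ln M + t%:R.
Proof.
move=> t0 m0 U0 uU vU Hmin M0 HM.
have tR : 0 < t%:R :> R by rewrite ltr0n.
have lt0 : 0 <= ln (t%:R : R) by rewrite ln_ge0 // ler1n.
pose ok i s y q := leftok (marks (catrev s (y :: q))) i.+1 &&
       rightok (marks (catrev s (y :: q))) t i.+1.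
have step (i : 'I_t) : m * ln m + potential i.+1 - potential i <=
   m * ln M + (m / M * t%:R * pb i (fun s y q => (ok i s y q)%:R) -
   ln t%:R * m) + ln t%:R * (
     ps 0 t (fun s y q => (~~ leftok (marks (catrev s (y :: q))) i.+1)%:R) +
     ps 0 t (fun s y q => (~~ rightok (shifted (catrev s (y :: q))) t i.+1)%:R)).
  have it := ltn_ord i.
  rewrite -psum_entropy // -psum_not_left // -psum_not_right // -psumD.
  have bnd : m * ln M - ln t%:R * m >= 
     (ln M - 1 - ln t%:R) * pb i (fun s y q => B i y (head y q)) +
     m / M * pb i (fun _ _ _ => 1).
    rewrite psum_back1 // psum1 (_ : i.+1 + _ = t.+2)%N; last lia.
    have : m / M * measured t.+2 <= m.
      by rewrite -mulrA ger_pMr // mulrC ler_pdivrMr ?mul1r.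
    lra.
  rewrite [leRHS](_ : _ = (m * ln M - ln t%:R * m) +
    (m / M * t%:R * pb i (fun s y q => (ok i s y q)%:R) +
    pb i (fun s y q => ln t%:R *
     (B i y (head y q) * (~~ leftok (marks (catrev s (y :: q))) i.+1)%:R +
      B i y (head y q) * (~~ rightok (marks (catrev s (y :: q))) t i.+1)%:R)))); last by rewrite psumZ; ring.
  apply: le_trans (lerD bnd (lexx _)).
  rewrite -!psumZ -!psumD; apply: le_psum => // s y q.
  set b := B i y _; have b0 : 0 <= b by apply: backratio_ge0.
  rewrite /ok; set L := leftok _ _; set Rt := rightok _ _ _.
  have [] := boolP (L && Rt).
    (* A walk that decodes to [i] should have density about [m t / M], so the tangent is taken
       there. *)
    have c0 : 0 < M / t%:R by rewrite divr_gt0.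
    move=> /andP[-> ->] /=; apply: le_trans (xlnx_le b0 m0 c0) _.
    rewrite ln_div ?posrE // invf_div mulr0 addr0 mulr0.
    have : 0 <= m / M by rewrite divr_ge0 ?ltW.
    by lra.
  rewrite negb_and => LR.
  (* Elsewhere the tangent at [m / M] is used, at an extra cost of [ln t] times the failing mass. *)
  apply: le_trans (xlnx_le b0 m0 M0) _ => /=.
  have : ln t%:R * b <= ln t%:R * (b * (~~ L)%:R + b * (~~ Rt)%:R).
    rewrite ler_wpM2l // -mulrDr ler_peMr // -natrD ler1n.
    by move: LR; case: L Rt => -[].
  by rewrite mulr0; lra.
have tot : \sum_(i < t) (m * ln m + potential i.+1 - potential i) =
    t%:R * (m * ln m) + (potential t - potential 0).
  under eq_bigr => i _ do rewrite -addrA.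
  rewrite big_split /= sumr_const card_ord -[in LHS]mulr_natl; congr (_ + _).
  by rewrite -(telescope_sumr _ (leq0n t)) big_mkord.
have := ler_sum (index_enum _) (fun (i : 'I_t) (_ : true) => step i).
rewrite tot !big_split /= sumrN -!mulr_sumr !big_split /= !sumr_const card_ord.
set X := \sum_(i < t) pb i _; set Y := _ + \sum_(i < t) ps 0 t _ => H.
have hX : m / M * t%:R * X <= m * t%:R.
  have : X <= M by apply: le_trans HM; exact: sum_ok.
  move=> XM; rewrite mulrAC ler_pM2r // -mulrA ger_pMr // mulrC ler_pdivrMr //.
  by rewrite mul1r.
have hY : ln t%:R * Y <= ln t%:R * (t%:R * m / 2).
  by rewrite ler_wpM2l //; apply: sum_not_ok => //; apply: ltW.
have hP := potential_ends m0 U0 uU vU.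
rewrite -(ler_pM2l m0); move: H.
rewrite -[ln M *+ t]mulr_natl -[m *+ t]mulr_natl.
move: (ln t%:R) (ln m) (ln M) (ln (m / U)) hX hY hP => a b c d.
move: (m / M * _ * _) => e; move: (a * Y) => f; lra.
Qed.

End NearLogConvexity.

(** * The dichotomy for a pair of functions *)

Section Dichotomy.
Context {R : realType} {T : finType} (S : T -> T -> R).
Hypothesis S_ge0 : forall x y, 0 <= S x y.
Hypothesis S_sym : forall x y, S x y = S y x.
Variables (u v : T -> R).
Hypothesis u_ge0 : forall x, 0 <= u x.
Hypothesis v_ge0 : forall x, 0 <= v x.

(** The minimum is at most [sqrt (x y) = sqrt (p q)], which is twice the geometric mean of [p / 16]
    and [4 q]. *)
Lemma min_le_mix (x y p q : R) : 0 <= x -> 0 <= y -> 0 <= p -> 0 <= q ->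
  x * y = p * q -> Num.min x y <= p / 16 + 4 * q.
Proof.
move=> x0 y0 p0 q0 e.
have r0 : 0 <= p / 16 + 4 * q by lra.
have m0 : 0 <= Num.min x y by rewrite le_min x0.
rewrite -ler_sqr ?nnegrE // (@le_trans _ _ (x * y)) //.
  by rewrite expr2 ler_pM // ge_min lexx ?orbT.
rewrite e -subr_ge0 (_ : _ - _ = (p / 16 - 4 * q) ^+ 2); last by field.
exact: sqr_ge0.
Qed.

Lemma measured_ge0 n : 0 <= measured S u v n.
Proof. by apply: sumr_ge0 => x _; rewrite mulr_ge0 ?(iter_heat_ge0 S_ge0). Qed.

(** After exchanging the factors from [u], the product of the two occupations is that of the
    densities belonging to [m_(t-2)] and [m_(t+2)]. *)
Lemma sum_min_occ t k : (2 <= k <= t)%N ->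
  \sum_x Num.min (occ S u v t k.-2 x) (occ S u v t k x) <=
  measured S u v (t - 2) / 16 + 4 * measured S u v t.+2.
Proof.
move=> kt.
have -> : (t - 2 = k.-2 + (t - k))%N by lia.
have -> : (t.+2 = k + (t - k.-2))%N by lia.
rewrite -!(measured_split S_sym) mulr_suml mulr_sumr -big_split ler_sum // => x _.
by apply: min_le_mix; rewrite ?mulr_ge0 ?(iter_heat_ge0 S_ge0) // /occ; ring.
Qed.

(** This is [e / sqrt t * (4 Z)^(2/t)], the bound on [m_t / m_(t+2)] from near log-convexity when
    [m_t > U / (4 Z)]. *)
Definition growth (t : nat) (Z : R) : R :=
  expR (1 - ln t%:R / 2 + 2 / t%:R * ln (4 * Z)).

(** The right side adds up the bounds of three cases: small [m_t], the mean inequality, near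
    log-convexity. [Z] will bound the number of rectangles, over which the first term sums to at
    most [U / 4]. *)
Lemma measured_le t (Z U : R) : (0 < t)%N -> 0 < Z -> 0 < U ->
  \sum_x u x ^+ 2 <= U -> \sum_x v x ^+ 2 <= U ->
  measured S u v t <= U / (4 * Z) + measured S u v (t - 2) / 4 +
    (16 + growth t Z) * measured S u v t.+2.
Proof.
move=> t0 Z0 U0 uU vU.
have := measured_ge0 (t - 2); have := measured_ge0 t.+2.
set m := measured S u v t; set m' := measured _ _ _ t.+2; set m2 := measured _ _ _ (t - 2).
move=> m'0 m20.
have L0 : 0 < growth t Z by apply: expR_gt0.
have Lm0 : 0 <= growth t Z * m' by rewrite mulr_ge0 // ltW.
have Z4 : 0 < 4 * Z by lra.
have q0 : 0 < U / (4 * Z) by apply: divr_gt0.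
have [|big] := leP m (U / (4 * Z)); first by lra.
have [|H1] := leP m (m2 / 4 + 16 * m'); first by lra.
suff : m <= growth t Z * m' by lra.
rewrite leNgt; apply/negP => H2.
have m0 : 0 < m by apply: lt_trans big.
have [x0 _] : {x0 : T | true}.
  case: (pickP (@predT T)) => [x _|H]; first by exists x.
  by exfalso; move: m0; rewrite /m /measured big_pred0 ?ltxx // => x; have := H x.
have tR : 0 < t%:R :> R by rewrite ltr0n.
have := @near_log_convexity _ _ S S_ge0 S_sym u v x0 t u_ge0 v_ge0
  (m / growth t Z) U t0 m0 U0 uU vU.
have Hmin k : (2 <= k <= t)%N ->
   \sum_x Num.min (occ S u v t k.-2 x) (occ S u v t k x) <= measured S u v t / 4.
  by move=> kt; apply: le_trans (sum_min_occ kt) _; rewrite -/m -/m' -/m2; lra.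
move=> /(_ Hmin (divr_gt0 m0 L0)) H.
move: H; rewrite ler_pdivlMr // mulrC => /(_ (ltW H2)).
rewrite ln_div ?posrE // expRK.
have lb : - ln (4 * Z) < ln (m / U).
  rewrite -lnV ?posrE // ltr_ln ?posrE ?invr_gt0 ?divr_gt0 //.
  by rewrite ltr_pdivlMr // mulrC.
have -> : t%:R * (ln m - (1 - ln t%:R / 2 + 2 / t%:R * ln (4 * Z))) =
   t%:R * ln m - t%:R + t%:R / 2 * ln t%:R - 2 * ln (4 * Z).
  by field; rewrite gt_eqF.
lra.
Qed.

Definition kernel s x y : R := iter s (heat S) (fun z => (z == y)%:R) x.

Lemma kernel_ge0 s x y : 0 <= kernel s x y.
Proof. by apply: iter_heat_ge0 => // z; rewrite ler0n. Qed.

Lemma iter_heat_kernel s f x :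
  iter s (heat S) f x = \sum_y kernel s x y * f y.
Proof.
elim: s x => [|s IH] x.
  rewrite (bigD1 x) //= /kernel /= eqxx mul1r big1 ?addr0 // => y.
  by rewrite eq_sym => /negPf ->; rewrite mul0r.
rewrite iterS /heat; under eq_bigr => z _ do rewrite IH mulr_sumr.
rewrite exchange_big; apply: eq_bigr => y _ /=.
by rewrite [in RHS]/kernel /= [in RHS]/heat mulr_suml; apply: eq_bigr => z _; rewrite mulrA.
Qed.

End Dichotomy.

(** * Walks on the hypercube and protocols *)

Arguments kernel : simpl never.

Section Hypercube.
Context {R : realType} (n : nat).
Hypothesis n_gt0 : (0 < n)%N.
Implicit Types x y z : bvec n.

Definition flip x (j : 'I_n) : bvec n := [ffun i => x i (+) (i == j)].

Lemma flipK j : involutive (flip^~ j).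
Proof. by move=> x; apply/ffunP => i; rewrite !ffunE addbK. Qed.

Definition step x y : R := n%:R^-1 * \sum_j (flip x j == y)%:R.

Lemma step_ge0 x y : 0 <= step x y.
Proof. by rewrite mulr_ge0 ?invr_ge0 ?sumr_ge0. Qed.

Lemma step_sym x y : step x y = step y x.
Proof.
congr (_ * _); apply: eq_bigr => j _; congr (nat_of_bool _)%:R.
by apply/eqP/eqP => <-; rewrite flipK.
Qed.

Lemma heat_step f x : heat step f x = n%:R^-1 * \sum_j f (flip x j).
Proof.
rewrite /heat /step; under eq_bigr => y _ do rewrite -mulrA mulr_suml.
rewrite -mulr_sumr exchange_big; congr (_ * _); apply: eq_bigr => j _ /=.
rewrite (bigD1 (flip x j)) //= eqxx mul1r big1 ?addr0 // => y.
by rewrite eq_sym => /negPf ->; rewrite mul0r.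
Qed.

Lemma sum_kernel s x : \sum_y kernel step s x y = 1.
Proof.
transitivity (iter s (heat step) (fun=> 1) x).
  by rewrite iter_heat_kernel; apply: eq_bigr => y _; rewrite mulr1.
elim: s x => [//|s IH] x.
rewrite iterS heat_step; under eq_bigr => j _ do rewrite IH.
by rewrite sumr_const card_ord mulVf // pnatr_eq0 -lt0n.
Qed.

Lemma hamming_flip x z j : x j = z j -> hamming x (flip z j) = (hamming x z).+1.
Proof.
move=> e; rewrite /hamming.
have -> : [set i | x i != flip z j i] = j |: [set i | x i != z i].
  apply/setP => i; rewrite !inE ffunE; case: (eqVneq i j) => [->|_]; last by rewrite addbF.
  by rewrite e; case: (z j).
by rewrite cardsU1 inE e eqxx.
Qed.

(** From distance [s] the next flip undoes an earlier one with probability [s / n]; these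
    probabilities are added over the steps. *)
Lemma kernel_collision s x :
  \sum_y kernel step s x y * (hamming x y != s)%:R <= (s ^ 2)%:R / n%:R.
Proof.
have n0 : 0 < n%:R :> R by rewrite ltr0n.
elim: s => [|s IH].
  rewrite exp0n // mul0r -(iter_heat_kernel _ _ (fun y => (hamming x y != 0%N)%:R)) /=.
  suff -> : hamming x x = 0%N by [].
  by apply/eqP; rewrite cards_eq0; apply/eqP/setP => i; rewrite !inE eqxx.
rewrite -(iter_heat_kernel _ _ (fun y => (hamming x y != s.+1)%:R)) iterSr iter_heat_kernel.
have H z : heat step (fun y => (hamming x y != s.+1)%:R) z <=
    (hamming x z != s)%:R + s%:R / n%:R.
  rewrite heat_step mulrC -ler_pdivlMr ?invr_gt0 // invrK mulrDl divfK ?(gt_eqF n0) //.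
  have [e|ne] /= := eqVneq (hamming x z) s; last first.
    rewrite mul1r; apply: ler_wpDr; first exact: ler0n.
    have -> : n%:R = \sum_(j < n) 1 :> R by rewrite sumr_const card_ord.
    apply: ler_sum => j _; by case: (_ != _).
  rewrite mul0r add0r.
  have -> : s%:R = \sum_(j < n) (x j != z j)%:R :> R.
    rewrite -e /hamming -sum1_card natr_sum big_mkcond /=.
    by apply: eq_bigr => j _; rewrite inE; case: (_ != _).
  apply: ler_sum => j _; case: (eqVneq (x j) (z j)) => [/hamming_flip ->|_] /=.
    by rewrite e eqxx.
  by case: (_ != _).
apply: (@le_trans _ _ (\sum_y kernel step s x y * ((hamming x y != s)%:R + s%:R / n%:R))).
  by apply: ler_sum => y _; apply: ler_wpM2l => //; apply: kernel_ge0; apply: step_ge0.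
under eq_bigr => y _ do rewrite mulrDr.
rewrite big_split /= -mulr_suml sum_kernel mul1r.
apply: le_trans (lerD IH (lexx _)) _.
rewrite -mulrDl ler_pM2r ?invr_gt0 // -natrD ler_nat; nia.
Qed.

End Hypercube.

(** Each bit splits the current rectangle [A x B] in two. The cost is bounded on [A x B] only, since
    a subtree is reached from there only. The sum counts the rectangles through a point, so they are
    disjoint. *)
Lemma proto_rects (X Y : Type) (P : proto X Y) C (A : X -> bool) (B : Y -> bool) :
  (forall x y, A x -> B y -> (bits P x y <= C)%N) ->
  {rs : seq ((X -> bool) * (Y -> bool)) | (size rs <= 2 ^ C)%N &
     forall x y, [&& A x, B y & run P x y] = (\sum_(r <- rs) (r.1 x && r.2 y))%N :> nat}.
Proof.
elim: P C A B => [b|f l IHl r IHr|f l IHl r IHr] C A B H.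
- exists (if b then [:: (A, B)] else [::]); first by case: (b) => /=; rewrite ?expn_gt0.
  by move=> x y; case: (b); rewrite ?big_cons big_nil /= ?andbT ?andbF ?addn0.
(* A node costs a bit, so [C = 0] forces [A x B] to be empty. *)
- case: C H => [|C] H.
    exists [::] => // x y; rewrite big_nil.
    by case a : (A x); case b : (B y) => //; have := H x y a b.
  have [|rl sl Hl] := IHl C (fun x => A x && ~~ f x) B.
    by move=> x y /andP[a /negPf fx] b; have := H x y a b; rewrite /= fx.
  have [|rr sr Hr] := IHr C (fun x => A x && f x) B.
    by move=> x y /andP[a fx] b; have := H x y a b; rewrite /= fx.
  exists (rl ++ rr); first by rewrite size_cat expnS mul2n -addnn leq_add.
  move=> x y; rewrite big_cat /= -Hl -Hr.
  by case: (A x) (B y) (f x) => -[] [] /=; rewrite ?addn0.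
- case: C H => [|C] H.
    exists [::] => // x y; rewrite big_nil.
    by case a : (A x); case b : (B y) => //; have := H x y a b.
  have [|rl sl Hl] := IHl C A (fun y => B y && ~~ f y).
    by move=> x y a /andP[b /negPf fx]; have := H x y a b; rewrite /= fx.
  have [|rr sr Hr] := IHr C A (fun y => B y && f y).
    by move=> x y a /andP[b fx]; have := H x y a b; rewrite /= fx.
  exists (rl ++ rr); first by rewrite size_cat expnS mul2n -addnn leq_add.
  move=> x y; rewrite big_cat /= -Hl -Hr.
  by case: (A x) (B y) (f y) => -[] [] /=; rewrite ?addn0.
Qed.

Definition points (R : realType) (n : nat) : R := #|bvec n|%:R.

Lemma points_gt0 (R : realType) (n : nat) : 0 < points R n.
Proof. by rewrite ltr0n card_ffun card_bool card_ord expn_gt0. Qed.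

Lemma sum_points (R : realType) (n : nat) (c : R) : \sum_(x : bvec n) c = points R n * c.
Proof. by rewrite sumr_const mulr_natl. Qed.

(** * Acceptance along the walk, and the bound for small error *)

Section Core.
Context {R : realType} (n k : nat) (delta : R) (I : finType) (w : I -> R).
Variable P : I -> proto (bvec n) (bvec n).
Hypothesis k_gt0 : (0 < k)%N.
Hypothesis kn : (k ^ 2)%:R < delta * n%:R.
Hypothesis w_ge0 : forall i, 0 <= w i.
Hypothesis w_sum : \sum_i w i = 1.
Hypothesis P_err : forall x y : bvec n, ham_promise k x y ->
  err_prob w P x y (hamming x y <= k)%N <= delta.

Let n_gt0 : (0 < n)%N.
Proof. by move: kn; case: n => // ; rewrite mulr0 ltNge ler0n. Qed.

Let nR : 0 < n%:R :> R. Proof. by rewrite ltr0n. Qed.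

Let delta_gt0 : 0 < delta.
Proof. by rewrite -(pmulr_lgt0 _ nR); apply: le_lt_trans kn. Qed.

Local Notation N := (points R n).
Local Opaque points.

Definition accept (x y : bvec n) : R := \sum_i w i * (run (P i) x y)%:R.
Definition mass s : R := \sum_x \sum_y kernel (@step R n) s x y * accept x y.

Lemma accept_ge0 x y : 0 <= accept x y.
Proof. by apply: sumr_ge0 => i _; rewrite mulr_ge0. Qed.

Lemma accept_le1 x y : accept x y <= 1.
Proof.
rewrite -w_sum; apply: ler_sum => i _; rewrite -[leRHS]mulr1 ler_wpM2l //.
by case: run.
Qed.

Lemma accept_far x y : hamming x y = k.+2 -> accept x y <= delta.
Proof.
move=> e; have := @P_err x y; rewrite e leqNgt ltnS leqnSn => H.
apply: le_trans (H _); last by right; right; rewrite e addn2.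
rewrite /err_prob big_mkcond /=; apply: ler_sum => i _.
by case: run => /=; rewrite ?mulr1 ?mulr0.
Qed.

Lemma accept_near x y : hamming x y = k -> 1 - accept x y <= delta.
Proof.
move=> e; have := @P_err x y; rewrite e leqnn => H.
apply: le_trans (H _); last by right; left.
rewrite /err_prob big_mkcond /= -w_sum -sumrB; apply: ler_sum => i _.
by case: run => /=; rewrite ?mulr1 ?mulr0 ?subrr ?subr0.
Qed.

(** Errors contribute [delta], and walks that miss distance [k + 2] contribute at most
    [(k + 2)^2 / n <= 9 k^2 / n < 9 delta]. *)
Lemma mass_far : mass k.+2 <= N * (10 * delta).
Proof.
rewrite -sum_points; apply: ler_sum => x _.
apply: (@le_trans _ _ (\sum_y kernel (@step R n) k.+2 x y *
    (delta + (hamming x y != k.+2)%:R))).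
  apply: ler_sum => y _; apply: ler_wpM2l; first by apply: kernel_ge0; apply: step_ge0.
  have [/accept_far|_] := eqVneq (hamming x y) k.+2; first by rewrite addr0.
  by have := accept_le1 x y; have := delta_gt0 => /=; lra.
under eq_bigr => y _ do rewrite mulrDr.
rewrite big_split /= -mulr_suml sum_kernel // mul1r.
have := @kernel_collision R n n_gt0 k.+2 x.
suff : (k.+2 ^ 2)%:R / n%:R <= 9 * delta by lra.
rewrite ler_pdivrMr // -mulrA (@le_trans _ _ (9 * (k ^ 2)%:R)) //.
  by rewrite -natrM ler_nat; nia.
by rewrite ler_pM2l // ltW.
Qed.

Lemma mass_near : N * (1 - 2 * delta) <= mass k.
Proof.
rewrite -sum_points; apply: ler_sum => x _.
have : 1 - \sum_y kernel (@step R n) k x y * accept x y <= delta + delta.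
  rewrite -(sum_kernel n_gt0 k x) -sumrB.
  apply: (@le_trans _ _ (\sum_y kernel (@step R n) k x y *
      (delta + (hamming x y != k)%:R))).
    apply: ler_sum => y _; rewrite -{1}[kernel _ _ _ _]mulr1 -mulrBr.
    apply: ler_wpM2l; first by apply: kernel_ge0; apply: step_ge0.
    have [/accept_near|_] := eqVneq (hamming x y) k; first by rewrite addr0.
    by have := accept_ge0 x y; have := delta_gt0 => /=; lra.
  under eq_bigr => y _ do rewrite mulrDr.
  rewrite big_split /= -mulr_suml sum_kernel // mul1r lerD2l.
  apply: le_trans (@kernel_collision R n n_gt0 k x) _.
  by rewrite ler_pdivrMr // ltW.
lra.
Qed.

Lemma mass_le s : mass s <= N.
Proof.
rewrite -[N]mulr1 -sum_points; apply: ler_sum => x _.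
rewrite -(sum_kernel n_gt0 s x); apply: ler_sum => y _.
by rewrite ler_piMr ?accept_le1 //; apply: kernel_ge0; apply: step_ge0.
Qed.

Lemma bits_le_rcost i x y : (bits (P i) x y <= rcost P)%N.
Proof.
rewrite /rcost (bigD1 i) //= leq_max (bigD1 x) //= !leq_max (bigD1 y) //= !leq_max.
by rewrite leqnn.
Qed.

Definition rects i : seq ((bvec n -> bool) * (bvec n -> bool)) :=
  s2val (@proto_rects _ _ (P i) (rcost P) predT predT
    (fun x y _ _ => bits_le_rcost i x y)).

Lemma size_rects i : (size (rects i) <= 2 ^ rcost P)%N.
Proof. by rewrite /rects; case: proto_rects. Qed.

Lemma run_rects i x y :
  run (P i) x y = (\sum_(r <- rects i) (r.1 x && r.2 y))%N :> nat.
Proof. by rewrite /rects; case: proto_rects => rs _ /= <-. Qed.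

Definition indic (A : bvec n -> bool) x : R := (A x)%:R.

Lemma mass_rects s : mass s = \sum_i w i *
  \sum_(r <- rects i) measured (@step R n) (indic r.2) (indic r.1) s.
Proof.
transitivity (\sum_i w i * \sum_x \sum_y kernel (@step R n) s x y * (run (P i) x y)%:R).
  rewrite /mass; under [RHS]eq_bigr => i _ do rewrite mulr_sumr.
  rewrite [RHS]exchange_big; apply: eq_bigr => x _ /=.
  under [RHS]eq_bigr => i _ do rewrite mulr_sumr.
  rewrite [RHS]exchange_big; apply: eq_bigr => y _ /=.
  by rewrite /accept mulr_sumr; apply: eq_bigr => i _; rewrite mulrCA.
apply: eq_bigr => i _; congr (_ * _).
rewrite [RHS]exchange_big; apply: eq_bigr => x _ /=.
under [RHS]eq_bigr => r _ do rewrite iter_heat_kernel mulr_sumr.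
rewrite [RHS]exchange_big; apply: eq_bigr => y _ /=.
rewrite run_rects natr_sum mulr_sumr; apply: eq_bigr => r _.
by rewrite /indic -mulnb natrM mulrCA.
Qed.

Lemma indic_sq A : \sum_x indic A x ^+ 2 <= N.
Proof.
rewrite -[N]mulr1 -sum_points; apply: ler_sum => x _.
by rewrite /indic; case: (A x); rewrite ?expr1n ?expr0n.
Qed.

(** [measured_le] with [t = k], [U = N], [Z = 2 ^ rcost P], summed over rectangles and averaged over
    random strings; by [mass (k - 2) <= N] its first two terms give at most [N / 2]. *)
Lemma acceptance_ineq :
  1 - 2 * delta <= 2^-1 + (16 + growth k (2 ^ rcost P)%:R) * (10 * delta).
Proof.
have lin (N' G a b c : R) : a <= N' / 4 + b / 4 + G * c -> b <= N' ->
    G * c <= G * (N' * (10 * delta)) -> a <= N' * (2^-1 + G * (10 * delta)) by lra.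
set Z := (2 ^ rcost P)%:R; have Z0 : 0 < Z :> R by rewrite ltr0n expn_gt0.
have N0 : 0 < N by exact: points_gt0.
rewrite -(ler_pM2l N0); apply: le_trans mass_near _.
have Gp : 0 <= 16 + growth k Z.
  by rewrite addr_ge0 // ltW // expR_gt0.
have H : mass k <= N / 4 + mass (k - 2) / 4 + (16 + growth k Z) * mass k.+2.
  have -> : N / 4 = \sum_i w i * (N / 4) by rewrite -mulr_suml w_sum mul1r.
  rewrite !mass_rects mulr_suml mulr_sumr -!big_split; apply: ler_sum => i _ /=.
  rewrite -mulrA [_ * (w i * _)]mulrCA -!mulrDr ler_wpM2l //.
  apply: (@le_trans _ _ (\sum_(r <- rects i) (N / (4 * Z) +
      measured (@step R n) (indic r.2) (indic r.1) (k - 2) / 4 +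
      (16 + growth k Z) * measured (@step R n) (indic r.2) (indic r.1) k.+2))).
    apply: ler_sum => r _; apply: measured_le => //;
      by [exact: step_ge0|exact: step_sym|exact: indic_sq|move=> x; exact: ler0n].
  rewrite !big_split /= mulr_suml mulr_sumr !lerD2r.
  rewrite big_const_seq count_predT iter_addr_0 -[_ *+ size _]mulr_natr.
  rewrite invfM mulrA -[leRHS]mulr1 -[leLHS]mulrA ler_pM2l ?divr_gt0 //.
  by rewrite mulrC ler_pdivrMr // mul1r ler_nat size_rects.
exact: lin H (mass_le _) (ler_wpM2l Gp mass_far).
Qed.

End Core.

Lemma half_ln_bound (R : realType) (x : R) : 0 < x -> x <= 2 ^- 26 ->
  13 * ln 2 <= - ln x / 2.
Proof.
move=> x0 xl; suff : ln x <= - (ln 2 *+ 26) by rewrite -mulr_natl; lra.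
by rewrite -lnXn // -lnV ?posrE ?exprn_gt0 // ler_ln ?posrE ?invr_gt0 ?exprn_gt0.
Qed.

(** The acceptance inequality forces [growth] to be at least [2^-7 / delta]; its logarithm then
    bounds the cost from below. *)
Lemma small_error_bound (R : realType) (n k : nat) (delta : R) (I : finType) (w : I -> R)
    (P : I -> proto (bvec n) (bvec n)) :
  (0 < k)%N -> (k ^ 2)%:R < delta * n%:R -> 0 < delta -> delta <= 2 ^- 26 ->
  (forall i, 0 <= w i) -> \sum_i w i = 1 ->
  (forall x y : bvec n, ham_promise k x y ->
     err_prob w P x y (hamming x y <= k)%N <= delta) ->
  k%:R / 4 * log2 (k%:R / delta) <= (rcost P)%:R.
Proof.
move=> k0 kn d0 dl w0 w1 err.
have ln2 : 0 < ln 2 :> R by rewrite ln_gt0 // ltr1n.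
have kR : 1 <= k%:R :> R by rewrite ler1n.
have d1 : delta <= 2^-1 ^+ 11.
  by rewrite exprVn (le_trans dl) // lef_pV2 ?posrE ?exprn_gt0 // ler_eXn2l ?ltr1n.
have lin (G : R) : 1 - 2 * delta <= 2^-1 + (16 + G) * (10 * delta) ->
  2^-1 ^+ 7 <= delta * G by lra.
have := acceptance_ineq k0 kn w0 w1 err.
set C := rcost P; set G := growth _ _ => /lin H.
have G0 : 0 < G by apply: expR_gt0.
have {}H : - (7 * ln 2) <= ln delta + (1 - ln k%:R / 2 + 2 / k%:R * ln (4 * (2 ^ C)%:R)).
  rewrite -[X in _ + X]expRK -/(growth _ _) -/G -lnM ?posrE //.
  rewrite mulr_natl -lnXn // -lnV ?posrE ?exprn_gt0 // ler_ln ?posrE ?invr_gt0 ?exprn_gt0 ?mulr_gt0 //.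
  by rewrite -exprVn.
have e1 : ln (4 * (2 ^ C)%:R) = (C%:R + 2) * ln 2 :> R.
  rewrite (_ : 4 * _ = 2 ^+ (C + 2)); last by rewrite exprD natrX mulrC; congr (_ * _); ring.
  by rewrite lnXn // -[_ *+ (C + 2)]mulr_natl natrD.
rewrite {}e1 in H; clearbody C; clear G G0 lin.
have e : 1 <= 2 * ln 2 :> R.
  suff : ln (2^-1) <= 2^-1 - 1 :> R by rewrite lnV ?posrE //; lra.
  by apply: ln_le_sub1; rewrite invr_gt0.
(* Half of [- ln delta] pays for [1 <= 2 ln 2], for [7 ln 2], and for [4 ln 2] to absorb the factor
   4 in [4 * 2 ^ C]: hence the threshold [2 ^- 26]. *)
have dh := half_ln_bound d0 dl.
rewrite /log2 ln_div ?posrE ?(lt_le_trans ltr01 kR) //.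
rewrite mulrA ler_pdivrMr //.
have k0R : 0 < k%:R :> R by apply: lt_le_trans kR.
have {}H : k%:R * (ln k%:R / 2 - ln delta - 1 - 7 * ln 2) <= 2 * ((C%:R + 2) * ln 2).
  rewrite mulrC -ler_pdivlMr // [leRHS]mulrAC; lra.
have : k%:R * (ln k%:R / 2 - ln delta / 2 + 4 * ln 2) <= 2 * ((C%:R + 2) * ln 2).
  by apply: le_trans H; rewrite ler_pM2l //; lra.
have : ln 2 <= k%:R * ln 2 :> R by rewrite ler_peMl // ltW.
lra.
Qed.

(** * Reductions *)

Section ProtocolOps.
Variables X Y X' Y' : Type.

Fixpoint pbind (P : proto X Y) (K : bool -> proto X Y) : proto X Y :=
  match P with
  | PLeaf b => K b
  | PAlice f l r => PAlice f (pbind l K) (pbind r K)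
  | PBob f l r => PBob f (pbind l K) (pbind r K)
  end.

Lemma run_pbind P K x y : run (pbind P K) x y = run (K (run P x y)) x y.
Proof. by elim: P => //= f l -> r ->; case: (f _). Qed.

Lemma bits_pbind P K x y :
  bits (pbind P K) x y = (bits P x y + bits (K (run P x y)) x y)%N.
Proof. by elim: P => //= f l -> r ->; case: (f _). Qed.

Fixpoint pvote (q : nat) (Ps : seq (proto X Y)) (c : nat) : proto X Y :=
  if Ps is P :: Ps' then pbind P (fun b => pvote q Ps' (c + b)) else PLeaf (q <= c)%N.

Lemma run_pvote q Ps c x y :
  run (pvote q Ps c) x y = (q <= c + count (fun P => run P x y) Ps)%N.
Proof. by elim: Ps c => [|P Ps IH] c /=; rewrite ?addn0 // run_pbind IH addnA. Qed.

Lemma bits_pvote q Ps c x y :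
  bits (pvote q Ps c) x y = (\sum_(P <- Ps) bits P x y)%N.
Proof.
by elim: Ps c => [|P Ps IH] c /=; rewrite ?big_nil // big_cons bits_pbind IH.
Qed.

Fixpoint pcomap (f : X' -> X) (g : Y' -> Y) (P : proto X Y) : proto X' Y' :=
  match P with
  | PLeaf b => PLeaf b
  | PAlice h l r => PAlice (h \o f) (pcomap f g l) (pcomap f g r)
  | PBob h l r => PBob (h \o g) (pcomap f g l) (pcomap f g r)
  end.

Lemma run_pcomap f g P x y : run (pcomap f g P) x y = run P (f x) (g y).
Proof. by elim: P => //= h l -> r ->. Qed.

Lemma bits_pcomap f g P x y : bits (pcomap f g P) x y = bits P (f x) (g y).
Proof. by elim: P => //= h l -> r ->. Qed.

End ProtocolOps.

Lemma rcost_le n (I : finType) (P : I -> proto (bvec n) (bvec n)) c :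
  (forall i x y, (bits (P i) x y <= c)%N) -> (rcost P <= c)%N.
Proof. by move=> H; do 3![apply/bigop.bigmax_leqP => ? _]. Qed.

(** * Majority votes *)

Section Amplify.
Context {R : realType} (n q : nat) (I : finType) (w : I -> R).
Variable P : I -> proto (bvec n) (bvec n).
Hypothesis w_ge0 : forall i, 0 <= w i.
Hypothesis w_sum : \sum_i w i = 1.

Definition wrep (f : {ffun 'I_(q.*2) -> I}) : R := \prod_j w (f j).
Definition prep (f : {ffun 'I_(q.*2) -> I}) : proto (bvec n) (bvec n) :=
  pvote q [seq P (f j) | j <- enum 'I_(q.*2)] 0.

Lemma wrep_ge0 f : 0 <= wrep f.
Proof. by apply: prodr_ge0. Qed.

Lemma wrep_sum : \sum_f wrep f = 1.
Proof.
rewrite /wrep -(bigA_distr_bigA (fun _ => w)) /=.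
by rewrite big1.
Qed.

Lemma rcost_prep : (rcost prep <= q.*2 * rcost P)%N.
Proof.
apply: rcost_le => f x y; rewrite bits_pvote big_map big_enum /=.
apply: (@leq_trans (\sum_(j < q.*2) rcost P)).
  by apply: leq_sum => j _; apply: bits_le_rcost.
by rewrite sum_nat_const card_ord.
Qed.

(* Exponential Markov inequality with base 2: a wrong majority has at least
   [q] wrong votes, and [E 2^(wrong votes) = (1 + err)^(2q)]. *)
Lemma err_prep x y b : err_prob w P x y b <= 3^-1 ->
  err_prob wrep prep x y b <= (8 / 9) ^+ q.
Proof.
move=> e3.
pose a i : R := if run (P i) x y != b then 2 else 1.
have a1 i : 1 <= a i by rewrite /a; case: ifP => _; rewrite ?ler1n.
have sa : \sum_i w i * a i = 1 + err_prob w P x y b.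
  rewrite -w_sum /err_prob [X in _ + X]big_mkcond -big_split /=; apply: eq_bigr => i _.
  by rewrite /a; case: ifP => _; ring.
have e0 : 0 <= err_prob w P x y b by apply: sumr_ge0.
(* The base is [(1 + 1/3)^2 / 2 = 8/9]. *)
apply: (@le_trans _ _ ((\sum_i w i * a i) ^+ q.*2 / 2 ^+ q)); last first.
  rewrite ler_pdivrMr ?exprn_gt0 // -exprMn -mul2n exprM lerXn2r ?nnegrE ?sqr_ge0 //; first lra.
  by rewrite sa; nra.
rewrite ler_pdivlMr ?exprn_gt0 //.
have -> : (\sum_i w i * a i) ^+ q.*2 = \sum_(f : {ffun 'I_(q.*2) -> I}) \prod_j (w (f j) * a (f j)).
  by rewrite -(bigA_distr_bigA (fun _ i => w i * a i)) prodr_const card_ord.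
rewrite /err_prob mulr_suml big_mkcond /=; apply: ler_sum => f _.
rewrite big_split /= -/(wrep f).
have pa : 0 <= \prod_j a (f j) by apply: prodr_ge0 => j _; apply: le_trans (a1 _).
case: ifP => [bad|_]; last by rewrite mulr_ge0 ?wrep_ge0.
apply: ler_wpM2l; first exact: wrep_ge0.
have -> : \prod_j a (f j) = 2 ^+ (\sum_j (run (P (f j)) x y != b)) :> R.
  rewrite -prodrXr; apply: eq_bigr => j _; rewrite /a.
  by case: (_ != _); rewrite ?expr0 ?expr1.
rewrite ler_eXn2l ?ltr1n //.
move: bad; rewrite run_pvote add0n.
have -> : count (fun Q => run Q x y) [seq P (f j) | j <- enum 'I_(q.*2)] =
    (\sum_j run (P (f j)) x y)%N.
  rewrite -sum1_count big_map big_mkcond big_enum /=.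
  by apply: eq_bigr => j _; case: run.
have : (\sum_(j < q.*2) (run (P (f j)) x y) + \sum_(j < q.*2) ~~ run (P (f j)) x y = q.*2)%N.
  rewrite -big_split /= -[RHS]card_ord -sum1_card.
  by apply: eq_bigr => j _; case: run.
case: (b) => /=.
  have -> : (\sum_(j < q.*2) (run (P (f j)) x y != true) =
     \sum_(j < q.*2) ~~ run (P (f j)) x y)%N by apply: eq_bigr => j _; case: run.
  by move: (\sum_j _)%N (\sum_j _)%N => a1' a2; case: (leqP q a1') => //; lia.
have -> : (\sum_(j < q.*2) (run (P (f j)) x y != false) =
   \sum_(j < q.*2) run (P (f j)) x y)%N by apply: eq_bigr => j _; case: run.
by move: (\sum_j _)%N (\sum_j _)%N => a1' a2; case: (leqP q a1') => //; lia.
Qed.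

End Amplify.

Section Padding.
Context (m d : nat).

(** Alice pads with [false] and Bob with [true], so threshold [k] after padding means [k - d]
    before. *)
Definition pad (b : bool) (x : bvec m) : bvec (m + d) :=
  [ffun i => if split i is inl j then x j else b].

Lemma hammingE n (x y : bvec n) : hamming x y = (\sum_i (x i != y i))%N.
Proof.
rewrite /hamming -sum1_card big_mkcond /=.
by apply: eq_bigr => i _; rewrite inE; case: (_ != _).
Qed.

Lemma hamming_pad x y : hamming (pad false x) (pad true y) = (hamming x y + d)%N.
Proof.
rewrite !hammingE big_split_ord /=; congr (_ + _)%N.
  by apply: eq_bigr => i _; rewrite !ffunE (unsplitK (inl _ i)).
rewrite -[RHS]card_ord -sum1_card; apply: eq_bigr => i _.
by rewrite !ffunE (unsplitK (inr _ i)).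
Qed.

End Padding.

(** * Protocols without communication *)

Section ZeroCost.
Context {R : realType} (n k : nat) (delta : R) (I : finType) (w : I -> R).
Variable P : I -> proto (bvec n) (bvec n).
Hypothesis w_sum : \sum_i w i = 1.

Lemma hamming_prefix j : (j <= n)%N ->
  hamming [ffun=> false] [ffun i : 'I_n => (i < j)%N] = j.
Proof.
move=> jn; rewrite hammingE.
transitivity (\sum_(0 <= i < n) (i < j)%N)%N.
  by rewrite big_mkord; apply: eq_bigr => i _; rewrite !ffunE; case: (_ < _)%N.
rewrite (big_cat_nat (leq0n j) jn) /= -[RHS]addn0; congr (_ + _)%N.
  rewrite (eq_big_nat _ _ (F2 := fun=> 1%N)) => [|i /andP[_ ->] //].
  by rewrite sum_nat_const_nat subn0 muln1.
by rewrite big_nat big1 // => i /andP[ji _]; rewrite ltnNge ji.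
Qed.

(** Each deterministic protocol is a single leaf, so it errs on exactly one of the two demands. *)
Lemma zero_cost_error x y x' y' : rcost P = 0%N ->
  err_prob w P x y true + err_prob w P x' y' false = 1.
Proof.
move=> c0; rewrite -w_sum /err_prob big_mkcond [X in _ + X]big_mkcond -big_split /=.
apply: eq_bigr => i _.
have := bits_le_rcost P i x y; rewrite c0; case: (P i) => //= b _.
by case: b; rewrite ?addr0 ?add0r.
Qed.

Lemma rcost_gt0 : (k + 2 <= n)%N -> delta <= 3^-1 ->
  (forall x y : bvec n, ham_promise k x y ->
     err_prob w P x y (hamming x y <= k)%N <= delta) ->
  (0 < rcost P)%N.
Proof.
move=> kn d3 H; rewrite lt0n; apply/negP => /eqP c0.
pose z : bvec n := [ffun=> false]; pose p (j : nat) : bvec n := [ffun i : 'I_n => (i < j)%N].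
have h1 : hamming z (p k) = k by apply: hamming_prefix; lia.
have h2 : hamming z (p (k + 2)%N) = (k + 2)%N by apply: hamming_prefix.
have := H z (p k); rewrite h1 leqnn => /(_ (or_intror (or_introl h1))) H1.
have := H z (p (k + 2)%N); rewrite h2 (_ : (k + 2 <= k)%N = false); last lia.
move=> /(_ (or_intror (or_intror h2))) H2.
have := zero_cost_error z (p k) z (p (k + 2)%N) c0; lra.
Qed.

End ZeroCost.

(** * Constant error, and assembly of the bound *)

Lemma amplified_error (R : realType) : (8 / 9 : R) ^+ 156 <= 2 ^- 26.
Proof.
(* [(8/9)^6 < 1/2]. *)
rewrite (_ : 156 = 6 * 26)%N // exprM -exprVn lerXn2r ?nnegrE ?exprn_ge0 //; lra.
Qed.

(** Padding lowers [k] to [k'], and a vote over [2 * 156 = 312] runs lowers the error to [2 ^- 26];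
    then [small_error_bound] applies. *)
Lemma large_error_bound (R : realType) (n k k' : nat) (delta : R) (I : finType) (w : I -> R)
    (P : I -> proto (bvec n) (bvec n)) :
  (0 < k')%N -> (k' <= k)%N -> (k - k' <= n)%N -> delta <= 3^-1 ->
  (k' ^ 2)%:R < 2 ^- 26 * (n - (k - k'))%:R :> R ->
  (forall i, 0 <= w i) -> \sum_i w i = 1 ->
  (forall x y : bvec n, ham_promise k x y ->
     err_prob w P x y (hamming x y <= k)%N <= delta) ->
  k'%:R / 4 * log2 (k'%:R / 2 ^- 26) <= 312 * (rcost P)%:R :> R.
Proof.
move=> k'0 k'k dn d3 kn w0 w1 err.
set d := (k - k')%N in dn kn.
move: kn P err; set m := (n - d)%N; have -> : n = (m + d)%N by rewrite subnK.
move=> kn P err.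
pose Q f := pcomap (pad d false) (pad d true) (prep (q := 156) P f).
apply: (@le_trans _ _ (rcost Q)%:R).
  apply: (small_error_bound (w := wrep w)) => //; first by rewrite invr_gt0 exprn_gt0.
  - exact: wrep_ge0.
  - exact: wrep_sum.
  move=> x y pr; rewrite /err_prob /Q; under eq_bigl => f do rewrite run_pcomap.
  apply: le_trans (amplified_error R); apply: err_prep => //.
  apply: le_trans d3; have := err (pad d false x) (pad d true y).
  rewrite hamming_pad.
  have -> : (hamming x y + d <= k)%N = (hamming x y <= k')%N by rewrite /d; lia.
  apply; rewrite /ham_promise hamming_pad.
  by move: pr; rewrite /ham_promise /d; lia.
rewrite -natrM ler_nat; apply: leq_trans (rcost_prep 156 P).
by apply: rcost_le => f x y; rewrite bits_pcomap bits_le_rcost.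
Qed.

Theorem theorem1p8 (R : realType) :
  exists c : R, 0 < c /\
  forall (n k : nat) (delta : R),
    (1 <= k)%N -> 0 < delta -> delta <= 3^-1 ->
    (k ^ 2)%:R < delta * n%:R ->
    forall (I : finType) (w : I -> R) (P : I -> proto (bvec n) (bvec n)),
      (forall i, 0 <= w i) -> \sum_(i : I) w i = 1 ->
      (forall x y : bvec n, ham_promise k x y ->
         err_prob w P x y (hamming x y <= k)%N <= delta) ->
      c * k%:R * log2 (k%:R / delta) <= (rcost P)%:R.
Proof.
(* [h ^ 2 = 2 ^ 26] matches the error threshold, and [h >= 16 * 312] absorbs the repetitions at the
   end. *)
pose h : R := 2 ^+ 13.
have h0 : 0 < h by rewrite exprn_gt0.
have hh : 2 ^- 26 = (h * h)^-1 :> R by rewrite /h -exprD.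
have hbig : 5000 <= h.
  by rewrite /h (_ : 13 = 3 + 10)%N // exprD (_ : 2 ^+ 10 = 1024) //; lra.
have ln2 : 0 < ln 2 :> R by rewrite ln_gt0 // ltr1n.
have log2M (x y : R) : 0 < x -> 0 < y -> log2 (x * y) = log2 x + log2 y.
  by move=> x0 y0; rewrite /log2 lnM ?posrE // mulrDl.
have log2X j : log2 (2 ^+ j) = j%:R :> R.
  by rewrite /log2 lnXn // -[_ *+ j]mulr_natl mulfK ?gt_eqF.
have log2_le (x y : R) : 0 < x -> x <= y -> log2 x <= log2 y.
  move=> x0 xy; rewrite /log2 ler_pM2r ?invr_gt0 // ler_ln ?posrE //.
  exact: lt_le_trans xy.
exists (h * h)^-1; split; first by rewrite invr_gt0 mulr_gt0.
move=> n k delta k1 d0 d3 kn I w P w0 w1 err.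
have kR : 1 <= k%:R :> R by rewrite ler1n.
have kR0 : 0 < k%:R :> R by apply: lt_le_trans kR.
have L0 : 0 <= log2 (k%:R / delta).
  have <- : log2 1 = 0 :> R by rewrite /log2 ln1 mul0r.
  by rewrite log2_le // ler_pdivlMr // mul1r (le_trans d3) // (le_trans _ kR) // invf_le1 // ler1n.
have hc : (h * h)^-1 <= 1 / 4.
  rewrite mul1r lef_pV2 ?posrE ?mulr_gt0 //; nra.
have [dl|dl] := leP delta (2 ^- 26).
  apply: le_trans (small_error_bound k1 kn d0 dl w0 w1 err).
  by rewrite ler_wpM2r // mulrC ler_pM2l //; lra.
have nk : (3 * k ^ 2 < n)%N.
  rewrite -(ltr_nat R) natrM.
  have : delta * n%:R <= 3^-1 * n%:R by rewrite ler_wpM2r.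
  move: kn; lra.
have nk' : (3 * (k * k) < n)%N by rewrite mulnn.
have kkk : (k <= k * k)%N by rewrite leq_pmulr.
have nk2 : (k + 2 <= n)%N by clear -k1 nk' kkk; lia.
have Lk : log2 (k%:R / delta) <= log2 k%:R + 26.
  rewrite -(log2X 26%N) -log2M ?exprn_gt0 //; apply: log2_le; first exact: divr_gt0.
  by rewrite ler_pM2l // -[leRHS]invrK lef_pV2 ?posrE ?invr_gt0 ?exprn_gt0 // ltW.
(* For bounded [k] the left side is at most [h (13 + 26) / h ^ 2 <= 1], and at least one bit is
   sent. *)
have [kD|kD] := ltnP k (2 ^ 13).
  have : (0 < rcost P)%N.
    exact: (rcost_gt0 w1 nk2 d3 err).
  rewrite -(ler_nat R); apply: le_trans.
  have kh : k%:R <= h by rewrite /h -natrX ler_nat ltnW.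
  have lk : log2 k%:R <= 13 :> R by rewrite -(log2X 13%N) log2_le.
  rewrite -mulrA mulrC ler_pdivrMr ?mulr_gt0 // mul1r.
  apply: ler_pM => //; lra.
set D := (2 ^ 13)%N in kD; have D0 : (0 < D)%N by rewrite expn_gt0.
have hD : h = D%:R by rewrite /h /D natrX.
(* As [D ^ 2 = 2 ^ 26], this [k'] meets the size condition for error [2 ^- 26]. *)
pose k' := (k %/ D)%N.
have k'0 : (0 < k')%N by rewrite divn_gt0.
have k'D : (k' * D <= k)%N by apply: leq_trunc_div.
have kk' : (k < k'.+1 * D)%N by apply: ltn_ceil.
clearbody D k'.
have k'k : (k' <= k)%N by apply: leq_trans k'D; rewrite leq_pmulr.
have := @large_error_bound R n k k' delta I w P k'0 k'k _ d3 _ w0 w1 err.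
have dn : (k - k' <= n)%N by clear -nk2; lia.
move=> /(_ dn); rewrite hh.
have H : (k' ^ 2)%:R < (h * h)^-1 * (n - (k - k'))%:R.
  rewrite mulrC ltr_pdivlMr ?mulr_gt0 // hD -!natrM ltr_nat -mulnn.
  apply: (@leq_ltn_trans (k * k)%N); first by rewrite mulnACA leq_mul.
  by clear -nk' kkk; lia.
move=> /(_ H); rewrite invrK => {}H.
have k'R : 1 <= k'%:R :> R by rewrite ler1n.
have k'R0 : 0 < k'%:R :> R by apply: lt_le_trans k'R.
have kle : k%:R <= 2 * h * k'%:R.
  rewrite hD -!natrM ler_nat (leq_trans (ltnW kk')) // -mulnA mulnCA mulnC leq_mul2l.
  by clear -k'0; lia.
have hhX : h * h = 2 ^+ 26 by rewrite /h -exprD.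
have L1 : log2 (k'%:R * (h * h)) = log2 k'%:R + 26.
  by rewrite hhX log2M ?exprn_gt0 // log2X.
have L2 : log2 (k%:R : R) <= log2 (k'%:R : R) + 14.
  rewrite -(log2X 14%N) -log2M ?exprn_gt0 //; apply: log2_le => //.
  by rewrite mulrC exprS -/h.
have L3 : 0 <= log2 k'%:R :> R.
  have <- : log2 1 = 0 :> R by rewrite /log2 ln1 mul0r.
  exact: log2_le.
rewrite -mulrA mulrC ler_pdivrMr ?mulr_gt0 //.
(* [log2 (k / delta) <= log2 k' + 14 + 26 <= 2 (log2 k' + 26)]. *)
apply: (@le_trans _ _ (2 * h * k'%:R * (2 * (log2 k'%:R + 26)))).
  apply: ler_pM => //; lra.
rewrite L1 in H.
have C0 : 0 <= (rcost P)%:R :> R by [].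
have : 16 * 312 * (rcost P)%:R <= h * (rcost P)%:R by rewrite ler_wpM2r //; lra.
move=> /(ler_wpM2l (ltW h0)).
move: H => /(ler_wpM2l (ltW h0)).
move: (rcost P)%:R (log2 (k'%:R : R)) (k'%:R : R) => a b c; lra.
Qed.
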